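(* Let $1<\alpha<\infty$. There exists an initial inflation factor $\theta_*$ such that for the input variance value $\tilde p_0=\theta_*p_0$ of the SPEnKF, the expected value of the variance deviation in the perturbed problem is zero in the step limit, meaning that $$\lim_{i\to\infty}\mathbb{E}[\Delta p_i]=0,$$ which, from the formula $$\mathbb{E}[\Delta p_i]=\frac{\alpha M_i^2r^2e^{\frac{\alpha r}{S_i\tilde p_0}}}{S_i(S_ip_0+r)}\left[-\frac{p_0}{\tilde p_0}E_\alpha\left(\frac{\alpha r}{S_i\tilde p_0}\right)+E_{\alpha+1}\left(\frac{\alpha r}{S_i\tilde p_0}\right)\right],$$ is equivalent to requiring that $$\lim_{i\to\infty} e^{\frac{\alpha r}{S_i\tilde p_0}}\left(E_{\alpha+1}\left(\frac{\alpha r}{S_i\tilde p_0}\right)-\frac{p_0}{\tilde p_0}E_\alpha\left(\frac{\alpha r}{S_i\tilde p_0}\right)\right)=0 .$$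
   Context: $E_n(z)=\int_1^\infty e^{-zt}t^{-n}\,dt$ is the generalized exponential integral. Let $m_0,m_1,\dots$ be nonzero reals (the scalar model), $r>0$ (observation error variance), $p_0,\tilde p_0>0$, $M_i=\prod_{j=0}^{i-1}m_j$ and $S_i=\sum_{l=0}^iM_l^2$ (empty product $=1$). The analysis variances $p^{\mathrm a}_i$ of the exact scalar Kalman filter with input variance $p_0$ are given by $p^{\mathrm f}_0=p_0$, $k_i=\frac{p^{\mathrm f}_i}{p^{\mathrm f}_i+r}$, $p^{\mathrm a}_i=(1-k_i)p^{\mathrm f}_i$, $p^{\mathrm f}_{i+1}=m_i^2p^{\mathrm a}_i$. The analysis variances $\hat p^{\mathrm a}_i$ of the SPEnKF (Scalar Pedagogical Ensemble Kalman Filter) with (perturbed) input variance $\tilde p_0$ and ensemble size $N=2\alpha$ follow the same recursion, started from the random sample variance $\frac1N\sum_{j=1}^N a_j^2\sim\Gamma(\alpha,\alpha/\tilde p_0)$ (shape, rate) of $N$ anomalies $a_j$ sampled from $\mathcal N(0,\tilde p_0)$. The variance deviation is $\Delta p_i=\hat p^{\mathrm a}_i-p^{\mathrm a}_i$; the expectation is over the random initial sample variance. *)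

(* Defs.v *)
From HB Require Import structures.
From mathcomp Require Import all_boot all_order all_algebra.
From mathcomp Require Import all_classical all_reals all_analysis.

Set Implicit Arguments.
Unset Strict Implicit.
Unset Printing Implicit Defensive.

Import Order.TTheory GRing.Theory Num.Theory.
Import numFieldNormedType.Exports.

Local Open Scope classical_set_scope.
Local Open Scope ring_scope.

(* E_n(z), for a real order [n] and a real argument [z]. It is only used with
   [0 < z], where the integral is finite; elsewhere [Rintegral] may be a
   default value. *)
Definition expint (R : realType) (n z : R) : R :=
  \int[lebesgue_measure]_(t in `[1, +oo[) (expR (- (z * t)) * t `^ (- n)).

Definition Gamma_fun (R : realType) (a : R) : R :=
  \int[lebesgue_measure]_(x in `]0, +oo[) (x `^ (a - 1) * expR (- x)).

(* [a] is the shape and [b] the rate. *)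
Definition gamma_pdf (R : realType) (a b : R) : R -> R :=
  (fun x => b `^ a / Gamma_fun a * x `^ (a - 1) * expR (- (b * x)))
    \_ `]0, +oo[.

Definition has_gamma_law (R : realType) (d : measure_display)
    (T : measurableType d) (P : probability T R) (a b : R)
    (X : {RV P >-> R}) : Prop :=
  forall A : set R, measurable A ->
    distribution P X A = (\int[lebesgue_measure]_(x in A) (gamma_pdf a b x)%:E)%E.

Section ScalarKalmanFilter.
Variables (R : realType) (m : nat -> R) (r : R).

Definition gain (pf : R) : R := pf / (pf + r).

Definition analysis (pf : R) : R := (1 - gain pf) * pf.

Fixpoint var_f (v : R) (i : nat) : R :=
  if i is j.+1 then m j ^+ 2 * analysis (var_f v j) else v.

Definition var_a (v : R) (i : nat) : R := analysis (var_f v i).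

Definition model_prod (i : nat) : R := \prod_(j < i) m j.

Definition info_sum (i : nat) : R := \sum_(l < i.+1) model_prod l ^+ 2.

End ScalarKalmanFilter.

(* The deviation of the ensemble filter, started from the sample variance
   [v], from the exact filter, started from [p0]. *)
Definition var_dev (R : realType) (m : nat -> R) (r p0 v : R) (i : nat) : R :=
  var_a m r v i - var_a m r p0 i.

(* The ensemble filter is driven by its initial sample variance only, a random
   variable of law Gamma(alpha, alpha / pt): for N = 2 alpha, this is the law of
   the sample variance of N independent N(0, pt) anomalies. *)
Definition mean_dev_vanishes (R : realType) (m : nat -> R) (r p0 alpha pt : R)
    : Prop :=
  forall (d : measure_display) (T : measurableType d) (P : probability T R)
    (X : {RV P >-> R}),
  has_gamma_law alpha (alpha / pt) X ->
  ('E_P[fun w => var_dev m r p0 (X w) i])%E @[i --> \oo] --> 0%E.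

(* The argument at which E_alpha and E_(alpha + 1) are evaluated at step i. *)
Definition step_arg (R : realType) (m : nat -> R) (r alpha pt : R) (i : nat)
    : R :=
  alpha * r / (info_sum m i * pt).

(* Main.v *)
Require Import Defs.
From HB Require Import structures.
From mathcomp Require Import all_boot all_order all_algebra.
From mathcomp Require Import all_classical all_reals all_analysis.
From mathcomp Require Import measurable_realfun lebesgue_integral_under ring lra.
Import Order.TTheory GRing.Theory Num.Theory.
Import numFieldNormedType.Exports.
Local Open Scope classical_set_scope.
Local Open Scope ring_scope.

(* The analysis variance at step [i] is M^2 r v / (S v + r) as a function of the
   input variance v, hence affine in 1 / (S v + r). For v of law Gamma(alpha, b)
   the mean of 1 / (S v + r) is (b / S) e^z E_alpha(z) with z = b r / S, by
   Tonelli, and alpha E_(alpha+1)(z) = e^(-z) - z E_alpha(z) turns this into the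
   formula for the mean deviation. As S_i increases, the arguments z_i decrease
   to a u, where u = 1 / theta and a >= 0 does not depend on theta (a = 0 when
   S_i diverges). The function E_(alpha+1)(a u) - u E_alpha(a u) is positive at
   u = 0 and nonpositive at u = 1; a zero u makes the bracket vanish in the
   limit, while its prefactor stays below alpha r because M_i^2 <= S_i. *)

(** * The exponential integral: positivity, monotonicity, recurrence, continuity *)

Section ExponentialIntegral.
Context {R : realType}.
Implicit Types n z t x : R.
Local Notation mu := (@lebesgue_measure R).

Lemma within_continuous_powR n (a : R) : 0 < a ->
  {within `[a, +oo[, continuous (fun x => x `^ n)}.
Proof.
move=> a0; apply: derivable_within_continuous => x; rewrite in_itv/= andbT => ax.
by apply: derivable_powR; rewrite in_itv/= andbT (lt_le_trans a0).
Qed.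

Lemma powRNn_cvg0 n : 0 < n -> t `^ (- n) @[t --> +oo] --> (0 : R).
Proof.
move=> n0; apply: (@cvg_trans _ (expR (- (n * ln t)) @[t --> +oo])).
  apply: near_eq_cvg; near=> t.
  have t0 : 0 < t by near: t; exact: nbhs_pinfty_gt.
  by rewrite /powR gt_eqF ?mulNr.
apply: (@cvg_comp _ _ _ _ (fun u => expR (- u)) _ +oo); last exact: cvgr_expR.
apply: gt0_cvgMry => //; apply/cvgryPge => A; near=> t.
(* Writing A as [ln (expR A)] reduces A <= ln t to expR A <= t, which holds for large t. *)
rewrite -[A]expRK.
have t0 : 0 < t by near: t; exact: nbhs_pinfty_gt.
rewrite ler_ln ?posrE ?expR_gt0//.
Unshelve. all: by end_near. Qed.

(** The fundamental theorem of calculus on a half-line, with the regularity of the primitive,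
    including right continuity at a, packed into one [is_derive] hypothesis. *)
Lemma integral_is_derivey (F f : R -> R) (a l : R) :
  (forall x, a <= x -> 0 <= f x) -> {within `[a, +oo[, continuous f} ->
  F x @[x --> +oo] --> l -> (forall x, a <= x -> is_derive x 1 F (f x)) ->
  (\int[mu]_(x in `[a, +oo[) (f x)%:E = l%:E - (F a)%:E)%E.
Proof.
move=> f0 cf Fl dF; apply: ge0_continuous_FTC2y => //.
- by move=> x /ltW/dF[].
- apply: cvg_at_right_filter; apply: differentiable_continuous.
  by apply/derivable1_diffP; have [] := dF a (lexx a).
- move=> x; rewrite in_itv/= andbT => /ltW/dF[_ <-].
  by rewrite derive1E.
Qed.

Lemma measurable_expint_integrand n z :
  measurable_fun [set: R] (fun t => expR (- (z * t)) * t `^ (- n)).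
Proof.
apply: measurable_funM; last exact: measurable_powR.
by apply: measurableT_comp => //; apply: measurableT_comp.
Qed.

Lemma integral_powRNn n : 1 < n ->
  (\int[mu]_(t in `[1%R, +oo[) (t `^ (- n))%:E = ((n - 1)^-1)%:E)%E.
Proof.
move=> n1; have n10 : n - 1 != 0 by rewrite gt_eqF// subr_gt0.
have dF x : 1 <= x -> is_derive x (1 : R) (fun t => - (n - 1)^-1 * t `^ (- (n - 1))) (x `^ (- n)).
  move=> x1; have x0 : 0 < x by exact: lt_le_trans x1.
  have D := is_derive1_powR (- (n - 1)) x0.
  apply: is_derive_eq; rewrite /GRing.scale/= mulrA mulrNN mulVf// mul1r.
  by congr (_ `^ _); ring.
rewrite (integral_is_derivey _ _ _ 0 _ _ _ dF).
- by rewrite powR1 mulr1 sub0e -EFinN opprK.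
- by move=> x _; exact: powR_ge0.
- exact: within_continuous_powR.
- rewrite -[X in _ --> X](mulr0 (- (n - 1)^-1)); apply: cvgMr.
  by apply: powRNn_cvg0; rewrite subr_gt0.
Qed.

Lemma integrable_powRNn n : 1 < n ->
  mu.-integrable `[1, +oo[ (fun t => (t `^ (- n))%:E).
Proof.
move=> n1; apply/integrableP; split.
  by apply/measurable_EFinP; apply: measurable_funTS; exact: measurable_powR.
under eq_integral do rewrite abse_EFin ger0_norm ?powR_ge0//.
by rewrite integral_powRNn// ltry.
Qed.

(** Domination by t^(-n), integrable because 1 < n. This covers z = 0, the limit of the step
    arguments when S_i diverges. *)
Lemma integrable_expint_integrand n z : 1 < n -> 0 <= z ->
  mu.-integrable `[1, +oo[ (fun t => (expR (- (z * t)) * t `^ (- n))%:E).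
Proof.
move=> n1 z0.
apply: (@le_integrable _ _ R mu _ _ _ (fun t => (t `^ (- n))%:E)) => //;
  last exact: integrable_powRNn.
  by apply/measurable_EFinP; apply: measurable_funTS; exact: measurable_expint_integrand.
move=> t/=; rewrite in_itv/= andbT => t1.
rewrite lee_fin normrM ler_piMl// ger0_norm ?expR_ge0// -expR0 ler_expR.
by rewrite oppr_le0 mulr_ge0// (le_trans _ t1).
Qed.

Lemma expintE n z : 1 < n -> 0 <= z ->
  (\int[mu]_(t in `[1%R, +oo[) (expR (- (z * t)) * t `^ (- n))%:E =
   (expint n z)%:E)%E.
Proof.
move=> n1 z0; rewrite fineK//.
exact/integrable_fin_num/integrable_expint_integrand.
Qed.

(** On [1, 2] the integrand is at least its value at t = 2, and the rest of the half-line
    contributes a nonnegative amount. *)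
Lemma expint_gt0 n z : 1 < n -> 0 <= z -> 0 < expint n z.
Proof.
move=> n1 z0; rewrite -lte_fin -expintE//.
have c0 : 0 < expR (- (z * 2)) * 2 `^ (- n) by rewrite mulr_gt0 ?expR_gt0 ?powR_gt0.
apply: (@lt_le_trans _ _ (\int[mu]_(t in `[1%R, 2%R]) (expR (- (z * 2)) * 2 `^ (- n))%:E)%E).
  rewrite integral_cst//= lebesgue_measure_itv/= lte_fin ltr1n -EFinD -EFinM lte_fin.
  by rewrite mulr_gt0// subr_gt0 ltr1n.
apply: (@le_trans _ _ (\int[mu]_(t in `[1%R, 2%R]) (expR (- (z * t)) * t `^ (- n))%:E)%E).
  apply: ge0_le_integral => //=.
  - apply/measurable_EFinP; apply: measurable_funTS; exact: measurable_expint_integrand.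
  - move=> t; rewrite in_itv/= => /andP[t1 t2]; rewrite lee_fin.
    have t0 : 0 < t by exact: lt_le_trans t1.
    rewrite ler_pM ?expR_ge0 ?powR_ge0//.
      by rewrite ler_expR lerN2 ler_wpM2l.
    rewrite !powRN lef_pV2 ?posrE ?powR_gt0//.
    by apply: ge0_ler_powR; rewrite ?nnegrE// ltW// (lt_trans ltr01).
apply: ge0_subset_integral => //=.
- apply/measurable_EFinP; apply: measurable_funTS; exact: measurable_expint_integrand.
- by move=> t _; rewrite lee_fin mulr_ge0 ?expR_ge0 ?powR_ge0.
- by apply: subset_itvl.
Qed.

Lemma expint_le n n' z : 1 < n -> n <= n' -> 0 <= z -> expint n' z <= expint n z.
Proof.
move=> n1 nn' z0; apply: le_Rintegral => //.
- by apply: integrable_expint_integrand => //; exact: lt_le_trans nn'.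
- exact: integrable_expint_integrand.
- move=> t/=; rewrite in_itv/= andbT => t1.
  by rewrite ler_wpM2l ?expR_ge0// ler_powR// lerN2.
Qed.

(** Integration by parts: the integrand of n E_(n+1)(z) + z E_n(z) is the derivative of -e^(-zt)
    t^(-n), which rises from -e^(-z) at t = 1 to 0 at infinity. *)
Lemma expint_recurrence n z : 1 < n -> 0 < z ->
  n * expint (n + 1) z = expR (- z) - z * expint n z.
Proof.
move=> n1 z0; have n0 : 0 < n by exact: lt_trans n1.
have n11 : 1 < n + 1 by rewrite ltrDr.
apply/eqP; rewrite eq_sym subr_eq eq_sym; apply/eqP.
rewrite -RintegralZl//; last by apply: integrable_expint_integrand => //; exact: ltW.
rewrite -RintegralZl//; last by apply: integrable_expint_integrand => //; exact: ltW.
rewrite -RintegralD//=; last 2 first.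
- apply: (@integrableZl _ _ R mu _ _ _ (EFin \o _)) => //=.
  by apply: integrable_expint_integrand => //; exact: ltW.
- apply: (@integrableZl _ _ R mu _ _ _ (EFin \o _)) => //=.
  by apply: integrable_expint_integrand => //; exact: ltW.
have dF x : 1 <= x -> is_derive x (1 : R) (fun t => - (expR (- (z * t)) * t `^ (- n)))
    (n * (expR (- (z * x)) * x `^ (- (n + 1))) + z * (expR (- (z * x)) * x `^ (- n))).
  move=> x1; have x0 : 0 < x by exact: lt_le_trans x1.
  have D := is_derive1_powR (- n) x0.
  apply: is_derive_eq; rewrite /GRing.scale/= /cst.
  rewrite (_ : - n - 1 = - (n + 1)); last by ring.
  ring.
rewrite /Rintegral (@integral_is_derivey _ _ _ 0 _ _ _ dF)//=.
- by rewrite sub0r opprK mulr1 powR1 mulr1.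
- move=> x _; rewrite addr_ge0// mulr_ge0 ?mulr_ge0 ?expR_ge0 ?powR_ge0// ltW//.
- have cg m : {within `[1, +oo[, continuous (fun x => expR (- (z * x)) * x `^ m)}.
    apply: derivable_within_continuous => x; rewrite in_itv/= andbT => x1.
    have D := is_derive1_powR m (lt_le_trans ltr01 x1).
    exact: ex_derive.
  move=> x; apply: cvgD; apply: cvgMl_tmp; exact: cg.
- rewrite -oppr0; apply: cvgN.
  apply: (@squeeze_cvgr _ _ _ _ (cst 0) (fun t => t `^ (- n))).
  + near=> t; have t0 : 0 < t by near: t; exact: nbhs_pinfty_gt.
    rewrite mulr_ge0 ?expR_ge0 ?powR_ge0//= ler_piMl ?powR_ge0//.
    by rewrite -expR0 ler_expR oppr_le0 mulr_ge0// ltW.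
  + exact: cvg_cst.
  + exact: powRNn_cvg0.
Unshelve. all: by end_near. Qed.

(* Extending by [expint n 0] to negative arguments makes the continuity on
   [0, +oo) a plain continuity on the line. *)
Lemma continuous_expint n : 1 < n ->
  continuous (fun z => expint n (Num.max z 0)).
Proof.
move=> n1 z.
(* The dominating function t^(-n) does not depend on the argument, so any neighbourhood of z will
   do. *)
apply: (@continuity_under_integral _ _ _ mu
  (fun x t => expR (- (Num.max x 0 * t)) * t `^ (- n)) `[1, +oo[ _ (z - 1) (z + 1)
  _ _ (fun t => t `^ (- n))) => //.
- by move=> x _; apply: integrable_expint_integrand => //; rewrite le_max lexx orbT.
- apply: aeW => t _ x _; apply: cvgMr_tmp.
  apply: (@continuous_comp _ _ _ (fun x => - (Num.max x 0 * t)) expR); last exact: continuous_expR.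
  apply: cvgN; apply: cvgMr_tmp.
  apply: continuous_max; [exact: cvg_id|exact: cvg_cst].
- exact: integrable_powRNn.
- move=> x _; apply: aeW => t/=; rewrite in_itv/= andbT => t1.
  rewrite normrM [X in _ * X]ger0_norm ?powR_ge0//.
  rewrite ler_piMl ?powR_ge0// ger0_norm ?expR_ge0// -expR0 ler_expR.
  by rewrite oppr_le0 mulr_ge0// ?le_max ?lexx ?orbT// (le_trans _ t1).
- by rewrite inE/= in_itv/= ltrBlDr ltrDl ltr01.
Qed.

End ExponentialIntegral.

(** * Closed form and measurability of the analysis variance *)

Section ScalarFilter.
Context {R : realType}.
Variables (m : nat -> R) (r : R).
Hypothesis r_gt0 : 0 < r.
Implicit Types v : R.

Lemma model_prodS i : model_prod m i.+1 = model_prod m i * m i.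
Proof. exact: big_ord_recr. Qed.

Lemma info_sumS i : info_sum m i.+1 = info_sum m i + model_prod m i.+1 ^+ 2.
Proof. exact: big_ord_recr. Qed.

Lemma info_sum0 : info_sum m 0 = 1.
Proof. by rewrite /info_sum big_ord1 /model_prod big_ord0 expr1n. Qed.

Lemma info_sum_nondecreasing : {homo info_sum m : i j / (i <= j)%N >-> i <= j}.
Proof.
apply: homo_leq => [//|x y z|i]; first exact: le_trans.
by rewrite info_sumS lerDl sqr_ge0.
Qed.

Lemma info_sum_gt0 i : 0 < info_sum m i.
Proof.
by rewrite (lt_le_trans ltr01)// -info_sum0 info_sum_nondecreasing.
Qed.

Lemma model_prod_sqr_le i : model_prod m i ^+ 2 <= info_sum m i.
Proof.
case: i => [|i]; first by rewrite info_sum0 /model_prod big_ord0 expr1n.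
by rewrite info_sumS lerDr ltW// info_sum_gt0.
Qed.

Lemma analysisE v : v + r != 0 -> analysis r v = r * v / (v + r).
Proof. by move=> vr; rewrite /analysis /gain; field. Qed.

(** For nonzero m_j this says M_i^2 / p_i = 1 / v + S_i / r: each analysis adds the information
    M_i^2 / r of one more observation. *)
Lemma var_aE v i : 0 < v ->
  var_a m r v i = model_prod m i ^+ 2 * r * v / (info_sum m i * v + r).
Proof.
move=> v0; elim: i => [|i IH].
  rewrite /var_a/= analysisE; last by rewrite gt_eqF// addr_gt0.
  by rewrite info_sum0 /model_prod big_ord0 expr1n !mul1r.
have Sv : 0 < info_sum m i * v + r by rewrite addr_gt0 ?mulr_gt0 ?info_sum_gt0.
rewrite /var_a/= -/(var_a m r v i) IH model_prodS info_sumS model_prodS.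
set M := model_prod m i; set S := info_sum m i.
have Sv' : 0 < (S + (M * m i) ^+ 2) * v + r.
  by rewrite mulrDl addrAC ltr_pwDl// mulr_ge0 ?sqr_ge0 ?ltW.
(* The denominator S_i v + r is common to the forecast variance and to the forecast variance plus r,
   so it cancels in the analysis and leaves S_(i+1) v + r. *)
have E : m i ^+ 2 * (M ^+ 2 * r * v / (S * v + r)) + r =
    r * ((S + (M * m i) ^+ 2) * v + r) / (S * v + r).
  by field; rewrite gt_eqF.
rewrite analysisE E; last by rewrite gt_eqF// divr_gt0// mulr_gt0.
by field; rewrite !gt_eqF.
Qed.

(** The inverse is expressed through the measurable [powR]: 1/y = y (y^2)^(-1), where squaring makes
    the base nonnegative; at y = 0 both sides take the value 0. *)
Lemma measurable_funV d (T : measurableType d) (f : T -> R) :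
  measurable_fun [set: T] f -> measurable_fun [set: T] (fun x => (f x)^-1).
Proof.
move=> mf; rewrite (_ : (fun x => _) = (fun x => f x * (f x ^+ 2) `^ (-1))).
  apply: measurable_funM => //.
  apply: (measurableT_comp (f := fun x : R => x `^ (-1))).
    exact: measurable_powR.
  exact: measurable_funX.
apply/funext => x; rewrite powR_inv1 ?sqr_ge0//.
by have [->|fx0] := eqVneq (f x) 0; [rewrite invr0 mul0r|field].
Qed.

(** This follows the recursion and not [var_aE], whose closed form is stated for v > 0 only. *)
Lemma measurable_var_a i : measurable_fun [set: R] (fun v => var_a m r v i).
Proof.
have ma (f : R -> R) : measurable_fun [set: R] f ->
    measurable_fun [set: R] (fun v => analysis r (f v)).
  move=> mf; apply: measurable_funM => //; apply: measurable_funB => //.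
  by apply: measurable_funM => //; apply: measurable_funV; exact: measurable_funD.
apply: (ma (fun v => var_f m r v i)); elim: i => [|i IH] /=; first exact: measurable_id.
by apply: measurable_funM => //; exact: (ma (fun v => var_f m r v i)).
Qed.

End ScalarFilter.

(** The density g and the Radon-Nikodym derivative of nu have the same integral over every
    measurable set, so they agree almost everywhere and the change of variables for the latter
    applies to g. *)
Lemma integral_density {R : realType} d (T : measurableType d)
    (nu : {finite_measure set T -> \bar R})
    (mu : {sigma_finite_measure set T -> \bar R}) (g : T -> R) (f : T -> \bar R) :
  measurable_fun [set: T] g ->
  (forall A, measurable A -> nu A = \int[mu]_(x in A) (g x)%:E)%E ->
  nu.-integrable [set: T] f ->
  (\int[nu]_x f x = \int[mu]_x (f x * (g x)%:E))%E.
Proof.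
move=> mg nug intf.
have numu : nu `<< mu.
  apply/null_content_dominatesP => A mA muA0; rewrite nug//.
  apply: null_set_integral => //; apply/measurable_EFinP.
  exact: measurable_funTS.
rewrite -(Radon_Nikodym_change_of_variables numu)//.
apply: ae_eq_integral => //.
- apply: emeasurable_funM; first exact: measurable_int intf.
  by apply: (measurable_int mu); exact: Radon_Nikodym_integrable.
- apply: emeasurable_funM; first exact: measurable_int intf.
  exact/measurable_EFinP.
- apply: ae_eqe_mul2l => /=; rewrite Radon_NikodymE.
  case: cid => /= h [h1 h2 h3].
  apply: integral_ae_eq => //=; first exact/measurable_EFinP.
  move=> E _ mE; transitivity (nu E); last exact: nug.
  by rewrite -h3.
Qed.

(** * Gamma integrals with respect to Lebesgue measure *)

Section GammaLaw.
Context {R : realType}.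
Implicit Types a b c q : R.
Local Notation mu := (@lebesgue_measure R).

(** The rate is a parameter because three values occur: 1 for Gamma(a), b for the density, and b t
    for the inner integral in Tonelli's theorem. *)
Definition gamma_integrand a c (x : R) : R := x `^ (a - 1) * expR (- (c * x)).

Lemma measurable_gamma_integrand a c :
  measurable_fun [set: R] (gamma_integrand a c).
Proof.
apply: measurable_funM; first exact: measurable_powR.
by apply: measurableT_comp => //; apply: measurableT_comp.
Qed.

Lemma gamma_integrand_ge0 a c x : 0 <= gamma_integrand a c x.
Proof. by rewrite mulr_ge0 ?powR_ge0 ?expR_ge0. Qed.

Lemma integral_gamma_cbnd a c :
  (\int[mu]_(x in `]0%R, +oo[) (gamma_integrand a c x)%:E =
   \int[mu]_(x in `[0%R, +oo[) (gamma_integrand a c x)%:E)%E.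
Proof.
apply: integral_itv_obnd_cbnd; apply/measurable_EFinP; apply: measurable_funTS.
exact: measurable_gamma_integrand.
Qed.

(** Substitution of c x for x: c^(a-1) from the power and c from the Jacobian make c^a. As 1 < a,
    the integrand tends to 0 at 0, which gives continuity at the endpoint. *)
Lemma integral_gamma_scale a c : 1 < a -> 0 < c ->
  (\int[mu]_(x in `]0%R, +oo[) (gamma_integrand a 1 x)%:E =
   (c `^ a)%:E * \int[mu]_(x in `]0%R, +oo[) (gamma_integrand a c x)%:E)%E.
Proof.
move=> a1 c0; have a10 : 0 < a - 1 by rewrite subr_gt0.
have dF : derive1 (fun x : R => c * x) = cst c.
  apply/funext => x; rewrite derive1E.
  have D : is_derive x (1 : R) (fun x : R => c * x) c.
    by apply: is_derive_eq; rewrite /GRing.scale/= /cst; ring.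
  by rewrite derive_val.
rewrite !integral_gamma_cbnd -{1}(mulr0 c).
rewrite (@increasing_ge0_integration_by_substitutiony _ (fun x => c * x) _ 0).
- rewrite -ge0_integralZl_EFin//=; last 3 first.
  + by move=> x _; rewrite lee_fin gamma_integrand_ge0.
  + apply/measurable_EFinP; apply: measurable_funTS; exact: measurable_gamma_integrand.
  + exact: powR_ge0.
  apply: eq_integral => x; rewrite inE/= in_itv/= andbT => x0.
  rewrite dF -EFinM; congr EFin.
  change ((c * x) `^ (a - 1) * expR (- (1 * (c * x))) * c =
    c `^ a * (x `^ (a - 1) * expR (- (c * x)))).
  rewrite mul1r powRM ?(ltW c0)//.
  rewrite -(mulr_powRB1 (ltW c0) (lt_trans ltr01 a1)).
  ring.
- by move=> x y _ _ xy; rewrite ltr_pM2l.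
- by rewrite dF => x _; exact: cvg_cst.
- by rewrite dF; exact: is_cvg_cst.
- by rewrite dF; exact: is_cvg_cst.
- split; first by move=> x _; exact: ex_derive.
  apply: cvg_at_right_filter; apply: cvgMl_tmp; exact: cvg_id.
- by apply: gt0_cvgMry => //; exact: cvg_id.
- rewrite mulr0; apply/continuous_within_itvcyP; split.
    move=> x; rewrite in_itv/= andbT => x0; apply: differentiable_continuous.
    apply/derivable1_diffP; have D := is_derive1_powR (a - 1) x0.
    exact: ex_derive.
  rewrite /gamma_integrand powR0 ?gt_eqF// mul0r.
  rewrite -[X in _ --> X](mul0r (expR (- (1 * 0)))); apply: cvgM.
    exact: powR_cvg0.
  apply: cvg_at_right_filter.
  have : derivable (fun x : R => expR (- (1 * x))) 0 1 by exact: ex_derive.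
  by move=> /derivable1_diffP/differentiable_continuous.
- by move=> x _; exact: gamma_integrand_ge0.
Qed.

Lemma integral_expRN c : 0 < c ->
  (\int[mu]_(t in `[1%R, +oo[) (expR (- (c * t)))%:E = (expR (- c) / c)%:E)%E.
Proof.
move=> c0.
have dF (x : R) : 1 <= x -> is_derive x (1 : R) (fun t => - (expR (- (c * t)) / c))
    (expR (- (c * x))).
  move=> _; apply: is_derive_eq; rewrite /GRing.scale/= /cst.
  by field; rewrite gt_eqF.
rewrite (@integral_is_derivey _ _ _ _ 0 _ _ _ dF).
- by rewrite sub0e -EFinN opprK mulr1.
- by move=> x _; exact: expR_ge0.
- apply: derivable_within_continuous => x _; exact: ex_derive.
- rewrite -oppr0; apply: cvgN; rewrite -[X in _ --> X](mul0r (c^-1)).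
  apply: cvgMr_tmp.
  apply: (@cvg_comp _ _ _ (fun t => c * t) (fun u => expR (- u)) _ +oo); last exact: cvgr_expR.
  by apply: gt0_cvgMry => //; exact: cvg_id.
Qed.

(* Tonelli for 1 / (x + q) = b e^(b (x + q)) \int_1^oo e^(- b (x + q) t) dt. *)
Lemma integral_gamma_resolvent a b q (G : R) : 1 < a -> 0 < b -> 0 < q ->
  (\int[mu]_(x in `]0%R, +oo[) (gamma_integrand a 1 x)%:E = G%:E)%E ->
  (\int[mu]_(x in `]0%R, +oo[) (gamma_integrand a b x / (x + q))%:E =
   (b `^ (1 - a) * G * (expR (b * q) * expint a (b * q)))%:E)%E.
Proof.
move=> a1 b0 q0 JG.
have a0 : 0 < a by exact: lt_trans a1.
(* The indicators move both domains into the integrand, so that Tonelli applies on the whole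
   plane. *)
pose f (z : R * R) : R := b * expR (b * q) *
  (z.1 `^ (a - 1) * \1_(`]0, +oo[ : set R) z.1 *
   (\1_(`[1, +oo[ : set R) z.2 * expR (- (b * (z.1 + q) * z.2)))).
have mI (A : set R) (h : R * R -> R) : measurable A ->
    measurable_fun [set: R * R] h ->
    measurable_fun [set: R * R] (fun z => \1_A (h z) : R).
  by move=> mA mh; apply: (measurableT_comp _ mh); exact: measurable_indic.
have mf : measurable_fun [set: R * R] f.
  apply: measurable_funM => //; apply: measurable_funM.
    apply: measurable_funM.
      exact: (measurableT_comp (f := fun x : R => x `^ (a - 1))).
    exact: mI.
  apply: measurable_funM.
    exact: mI.
  apply: measurableT_comp => //; apply: measurableT_comp => //.
  apply: measurable_funM => //; apply: measurable_funM => //.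
  exact: measurable_funD.
have f0 z : 0 <= f z.
  by rewrite !mulr_ge0 ?expR_ge0 ?powR_ge0// ltW.
transitivity (\int[mu]_x \int[mu]_t (f (x, t))%:E)%E.
  rewrite integral_mkcond; apply: eq_integral => x _.
  rewrite patchE; case: ifPn => [|x0]; last first.
    rewrite integral0_eq// => t _; rewrite /f/= indicE (negbTE x0).
    by rewrite !(mulr0, mul0r).
  move=> x0'; move: (x0'); rewrite inE/= in_itv/= andbT => x0.
  have xq : 0 < x + q by rewrite addr_gt0.
  transitivity (\int[mu]_(t in `[1%R, +oo[)
      ((b * expR (b * q) * x `^ (a - 1))%:E * (expR (- (b * (x + q) * t)))%:E))%E.
    rewrite ge0_integralZl_EFin//=; last 2 first.
    - apply/measurable_EFinP; apply: measurable_funTS.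
      by apply: measurableT_comp => //; apply: measurableT_comp.
    - by rewrite !mulr_ge0 ?expR_ge0 ?powR_ge0// ltW.
    rewrite integral_expRN ?mulr_gt0// -EFinM; congr EFin.
    have -> : expR (- (b * (x + q))) = expR (- (b * x)) / expR (b * q).
      by rewrite mulrDr opprD expRD (expRN (b * q)).
    rewrite /gamma_integrand.
    by field; rewrite !gt_eqF ?expR_gt0.
  rewrite integral_mkcond; apply: eq_integral => t _.
  rewrite patchE /f/= !indicE x0'.
  by case: ifPn => _; rewrite ?(mulr0, mul0r)// -EFinM mul1r mulr1 mulrA.
rewrite (fubini_tonelli (m1 := mu) (m2 := mu) (EFin \o f)); last 2 first.
- exact/measurable_EFinP.
- by move=> z; rewrite lee_fin.
transitivity (\int[mu]_(t in `[1%R, +oo[)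
    ((b `^ (1 - a) * G * expR (b * q))%:E * (expR (- (b * q * t)) * t `^ (- a))%:E))%E.
  rewrite [RHS]integral_mkcond; apply: eq_integral => t _.
  rewrite patchE; case: ifPn => [|t1]; last first.
    rewrite integral0_eq// => x _; rewrite /f/= !indicE (negbTE t1).
    by rewrite !(mulr0, mul0r).
  move=> t1'; move: (t1'); rewrite inE/= in_itv/= andbT => t1.
  have t0 : 0 < t by exact: lt_le_trans t1.
  (* For fixed t, what depends on x is a gamma integrand of rate b t, whose integral is (b t)^(-a)
     G. With the leading b this produces b^(1-a) and the weight t^(-a) of E_a. *)
  transitivity (\int[mu]_(x in `]0%R, +oo[)
      ((b * expR (b * q) * expR (- (b * q * t)))%:E * (gamma_integrand a (b * t) x)%:E))%E.
    rewrite [RHS]integral_mkcond; apply: eq_integral => x _.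
    rewrite patchE /f/= !indicE t1'.
    case: ifPn => _; rewrite ?(mulr0, mul0r)// -EFinM; congr EFin.
    rewrite mul1r mulr1 /gamma_integrand mulrDr mulrDl opprD expRD.
    by rewrite -(mulrAC b t x); ring.
  rewrite ge0_integralZl_EFin//=; last 3 first.
  - by move=> x _; rewrite lee_fin gamma_integrand_ge0.
  - apply/measurable_EFinP; apply: measurable_funTS; exact: measurable_gamma_integrand.
  - by rewrite !mulr_ge0 ?expR_ge0// ltW.
  have bt0 : 0 < b * t by rewrite mulr_gt0.
  have -> : (\int[mu]_(x in `]0%R, +oo[) (gamma_integrand a (b * t) x)%:E =
      ((b * t) `^ (- a) * G)%:E)%E.
    rewrite EFinM -JG (integral_gamma_scale _ _ a1 bt0) muleA -EFinM.
    by rewrite powRN mulVf ?mul1e// gt_eqF// powR_gt0.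
  rewrite -!EFinM; congr EFin.
  rewrite powRM ?ltW// powRB; last by rewrite (gt_eqF b0) implybT.
  by rewrite powRr1 ?ltW// (powRN b); ring.
rewrite ge0_integralZl_EFin//=.
- by rewrite expintE ?mulr_ge0 ?ltW// -EFinM mulrA.
- by move=> x _; rewrite lee_fin mulr_ge0 ?expR_ge0 ?powR_ge0.
- apply/measurable_EFinP; apply: measurable_funTS; exact: measurable_expint_integrand.
- rewrite !mulr_ge0 ?expR_ge0 ?powR_ge0//.
  by rewrite -lee_fin -JG integral_ge0// => x _; rewrite lee_fin gamma_integrand_ge0.
Qed.

End GammaLaw.

(** * Expectations under the gamma law *)

Section GammaMean.
Context {R : realType} d (T : measurableType d) (P : probability T R).
Variables (a b : R) (X : {RV P >-> R}).
Hypotheses (a_gt1 : 1 < a) (b_gt0 : 0 < b) (lawX : has_gamma_law a b X).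
Local Notation mu := (@lebesgue_measure R).

Lemma gamma_pdfE (x : R) : gamma_pdf a b x =
  if x \in `]0, +oo[%classic then b `^ a / Gamma_fun a * gamma_integrand a b x
  else 0.
Proof. by rewrite /gamma_pdf patchE; case: ifPn => // _; rewrite mulrA. Qed.

Lemma measurable_gamma_pdf : measurable_fun [set: R] (gamma_pdf a b).
Proof.
rewrite (_ : gamma_pdf a b =
    (fun x => b `^ a / Gamma_fun a * gamma_integrand a b x * \1_(`]0, +oo[ : set R) x)).
  apply: measurable_funM; last exact: measurable_indic.
  by apply: measurable_funM => //; exact: measurable_gamma_integrand.
apply/funext => x; rewrite gamma_pdfE indicE.
by case: ifPn => _; rewrite ?mulr1 ?mulr0.
Qed.

(* If the integral diverged, [Gamma_fun a] would be the default value 0 and the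
   density would vanish. *)
Lemma Gamma_fun_neq0 : Gamma_fun a != 0.
Proof.
apply/eqP => G0; have := lawX setT measurableT; rewrite probability_setT.
rewrite integral0_eq => [/eqP|x _]; first by rewrite onee_eq0.
by rewrite gamma_pdfE G0 invr0 mulr0 mul0r if_same.
Qed.

(** [Gamma_fun a] is the [fine] of this integral, and [fine] sends infinite values to 0; being
    nonzero, it comes from a finite integral. Convergence is thus drawn from the existence of the
    law. *)
Lemma Gamma_funE :
  (\int[mu]_(x in `]0%R, +oo[) (gamma_integrand a 1 x)%:E = (Gamma_fun a)%:E)%E.
Proof.
have E : Gamma_fun a = fine (\int[mu]_(x in `]0%R, +oo[) (gamma_integrand a 1 x)%:E)%E.
  congr fine; apply: eq_integral => x _.
  by rewrite /gamma_integrand mul1r.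
have := Gamma_fun_neq0; rewrite E.
by case: (integral _ _ _) => //=; rewrite eqxx.
Qed.

Lemma integral_gamma_law (h : R -> R) : measurable_fun [set: R] h ->
  (forall x, 0 <= h x) -> P.-integrable [set: T] (EFin \o (h \o X)) ->
  (\int[P]_w (h (X w))%:E = \int[mu]_(x in `]0%R, +oo[)
     (b `^ a / Gamma_fun a * gamma_integrand a b x * h x)%:E)%E.
Proof.
move=> mh h0 inth.
(* Lebesgue measure lives on [measurableTypeR R], whose display is not that of
   [R]. *)
pose Y : T -> measurableTypeR R := X.
have mY : measurable_fun [set: T] Y by exact: (measurable_funP X).
pose X' : {RV P >-> measurableTypeR R} :=
  HB.pack_for {mfun T >-> measurableTypeR R} Y (isMeasurableFun.Build _ _ _ _ Y mY).
have mh' : measurable_fun [set: measurableTypeR R] (EFin \o h).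
  exact/measurable_EFinP.
have -> : (\int[P]_w (h (X w))%:E = \int[distribution P X']_x (h x)%:E)%E.
  by rewrite (ge0_integral_distribution X' (f := EFin \o h)).
rewrite (@integral_density _ _ _ (distribution P X') mu (gamma_pdf a b))//.
- rewrite [RHS]integral_mkcond; apply: eq_integral => x _.
  rewrite patchE gamma_pdfE -EFinM; case: ifPn => _; last by rewrite mulr0.
  by rewrite mulrC.
- exact: measurable_gamma_pdf.
- apply/integrableP; split => //.
  rewrite (ge0_integral_distribution X' (f := fun x => `|(h x)%:E|%E))//.
    by case/integrableP : inth.
  exact: measurableT_comp.
Qed.

(** The density vanishes on ]-oo, 0]. This makes [var_aE] usable under the expectation. *)
Lemma gamma_law_gt0 : {ae P, forall w, 0 < X w}.
Proof.
exists (X @^-1` `]-oo, 0]); split.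
- by rewrite -[X in measurable X]setTI; exact: (measurable_funP X).
- rewrite [LHS](lawX `]-oo, 0]%classic)// integral0_eq// => x.
  rewrite /= in_itv/= => x0; rewrite gamma_pdfE ifF//; apply/negP.
  by rewrite inE/= in_itv/= andbT ltNge x0.
- by move=> w /=; rewrite in_itv/= => /negP; rewrite -leNgt.
Qed.

(** The truncation keeps the function between 0 and 1 / r on the whole line for s, r > 0, and
    changes nothing for x > 0, hence almost surely under the gamma law. *)
Definition resolvent (s r x : R) : R := (s * Num.max x 0 + r)^-1.

Variables (s r : R).
Hypotheses (s_gt0 : 0 < s) (r_gt0 : 0 < r).

Lemma resolvent_ge0 x : 0 <= resolvent s r x.
Proof.
by rewrite invr_ge0 addr_ge0 ?(ltW r_gt0)// mulr_ge0 ?(ltW s_gt0)// le_max lexx orbT.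
Qed.

Lemma resolvent_le x : resolvent s r x <= r^-1.
Proof.
have sx : 0 <= s * Num.max x 0 by rewrite mulr_ge0 ?(ltW s_gt0)// le_max lexx orbT.
by rewrite lef_pV2 ?posrE ?lerDr// ltr_wpDl.
Qed.

Lemma measurable_resolvent : measurable_fun [set: R] (resolvent s r).
Proof.
apply: measurable_funV; apply: measurable_funD => //.
by apply: measurable_funM => //; exact: measurable_maxr.
Qed.

Lemma integrable_resolvent : P.-integrable [set: T] (EFin \o (resolvent s r \o X)).
Proof.
apply: measurable_bounded_integrable => //.
- by apply: (le_lt_trans (probability_le1 P measurableT)); exact: ltry.
- by apply: (measurableT_comp measurable_resolvent).
- exists r^-1; split; first exact: num_real.
  move=> y ry w _.
  by rewrite /= ger0_norm ?resolvent_ge0// (le_trans (resolvent_le _))// ltW.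
Qed.

(** Since 1 / (s x + r) = (1 / s) / (x + r / s), this is [integral_gamma_resolvent] at q = r / s;
    the constants b^a / Gamma(a) and b^(1-a) Gamma(a) combine into b. *)
Lemma mean_resolvent : (\int[P]_w (resolvent s r (X w))%:E =
  (b / s * expR (b * r / s) * expint a (b * r / s))%:E)%E.
Proof.
rewrite integral_gamma_law; last 3 first.
- exact: measurable_resolvent.
- exact: resolvent_ge0.
- exact: integrable_resolvent.
have q0 : 0 < r / s by rewrite divr_gt0.
have G0 := Gamma_fun_neq0.
have C0 : 0 <= b `^ a / Gamma_fun a / s.
  rewrite !mulr_ge0 ?powR_ge0 ?invr_ge0 ?(ltW s_gt0)//.
  by apply: Rintegral_ge0 => x _; rewrite mulr_ge0 ?powR_ge0 ?expR_ge0.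
transitivity (\int[mu]_(x in `]0%R, +oo[)
    ((b `^ a / Gamma_fun a / s)%:E * (gamma_integrand a b x / (x + r / s))%:E))%E.
  apply: eq_integral => x; rewrite inE/= in_itv/= andbT => x0.
  rewrite -EFinM /resolvent max_l ?ltW//; congr EFin.
  have e1 : x * s + r != 0 by rewrite gt_eqF// addr_gt0// mulr_gt0.
  by field; rewrite G0 (gt_eqF s_gt0) /= e1.
rewrite ge0_integralZl_EFin//=; last 2 first.
- move=> x; rewrite in_itv/= andbT => x0.
  by rewrite lee_fin mulr_ge0 ?gamma_integrand_ge0// invr_ge0 addr_ge0 ?ltW.
- apply/measurable_EFinP; apply: measurable_funTS; apply: measurable_funM.
    exact: measurable_gamma_integrand.
  by apply: measurable_funV; exact: measurable_funD.
rewrite (integral_gamma_resolvent _ _ _ _ a_gt1 b_gt0 q0 Gamma_funE) -EFinM.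
congr EFin; rewrite (mulrA b r) powRB; last by rewrite (gt_eqF b_gt0) implybT.
rewrite powRr1 ?ltW// mulrA.
have ba : b `^ a != 0 by rewrite gt_eqF ?powR_gt0.
by field; rewrite ba G0 gt_eqF.
Qed.

End GammaMean.

(** * The mean deviation and the choice of the inflation factor *)

Lemma mean_var_dev {R : realType} (m : nat -> R) (r p0 alpha pt : R)
    d (T : measurableType d) (P : probability T R) (X : {RV P >-> R}) i :
  0 < r -> 0 < p0 -> 1 < alpha -> 0 < pt -> has_gamma_law alpha (alpha / pt) X ->
  ('E_P[fun w => var_dev m r p0 (X w) i])%E =
  (alpha * model_prod m i ^+ 2 * r ^+ 2 * expR (step_arg m r alpha pt i)
    / (info_sum m i * (info_sum m i * p0 + r))
    * (- (p0 / pt * expint alpha (step_arg m r alpha pt i))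
       + expint (alpha + 1) (step_arg m r alpha pt i)))%:E.
Proof.
move=> r0 p00 a1 pt0 lawX; have a0 : 0 < alpha by exact: lt_trans a1.
have b0 : 0 < alpha / pt by rewrite divr_gt0.
set z := step_arg _ _ _ _ _; set S := info_sum m i; set M := model_prod m i.
have S0 : 0 < S by exact: info_sum_gt0.
have z0 : 0 < z by rewrite divr_gt0 ?mulr_gt0.
have zE : alpha / pt * r / S = z by rewrite /z /step_arg -/S; field; rewrite !gt_eqF.
have Sp : 0 < S * p0 + r by rewrite addr_gt0 ?mulr_gt0.
(* From v / (S v + r) = (1 - r / (S v + r)) / S, the deviation is A - B / (S v + r), the exact
   variance being absorbed into A. *)
pose A := M ^+ 2 * r / S - M ^+ 2 * r * p0 / (S * p0 + r).
pose B := M ^+ 2 * r ^+ 2 / S.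
have intX := integrable_resolvent _ _ P X _ _ S0 r0.
have mX : measurable_fun [set: T] X by exact: (measurable_funP X).
transitivity (\int[P]_w (A%:E - B%:E * (resolvent S r (X w))%:E))%E.
  rewrite unlock; apply: ae_eq_integral => //.
  - apply/measurable_EFinP; apply: measurable_funB => //.
    exact: (measurableT_comp (measurable_var_a _ _ _)).
  - apply: emeasurable_funB => //; apply: emeasurable_funM => //.
    exact: measurable_int intX.
  - apply: (filterS _ (gamma_law_gt0 _ _ _ _ _ _ lawX)) => w Xw _.
    rewrite -EFinM -EFinB; congr EFin.
    rewrite /var_dev !var_aE// -/S -/M /resolvent max_l ?(ltW Xw)//.
    have SX : 0 < S * X w + r by rewrite addr_gt0 ?mulr_gt0.
    by rewrite /A /B; field; rewrite !gt_eqF.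
rewrite integralB//; last 2 first.
- by apply: finite_measure_integrable_cst.
- exact: integrableZl.
rewrite integral_cst// [X in (_ * X)%E]probability_setT mule1 integralZl//.
rewrite (mean_resolvent _ _ _ _ _ _ a1 b0 lawX _ _ S0 r0) zE.
rewrite -EFinM -EFinB; congr EFin.
have rec := expint_recurrence alpha z a1 z0.
(* With E_(alpha+1)(z) eliminated, both sides are rational in e^z and E_alpha(z), which can then be
   generalized. *)
have -> : expint (alpha + 1) z = (expR (- z) - z * expint alpha z) / alpha.
  by rewrite -rec mulrAC mulfV ?mul1r// gt_eqF.
rewrite expRN /A /B -zE; move: (expint _ _) (expR_gt0 (alpha / pt * r / S)) => E.
move: (expR _) => e e0.
by field; rewrite !gt_eqF.
Qed.

(** By the intermediate value theorem on [0, 1]; hence the u found is at most 1 and theta = 1 / u is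
    at least 1. For a = 0, E_n(0) = 1 / (n - 1) gives u = (alpha - 1) / alpha. *)
Lemma expint_balance {R : realType} (alpha a : R) : 1 < alpha -> 0 <= a ->
  exists2 u, 0 < u & expint (alpha + 1) (a * u) = u * expint alpha (a * u).
Proof.
move=> a1 a0; have a11 : 1 < alpha + 1 by rewrite ltr_wpDr.
pose E n u := expint n (Num.max (a * u) 0).
pose f u := E (alpha + 1) u - u * E alpha u.
have cE n : 1 < n -> continuous (E n).
  move=> n1 u; apply: (@continuous_comp _ _ _ (fun u => a * u)
    (fun z => expint n (Num.max z 0))); last exact: continuous_expint.
  by apply: cvgMl_tmp; exact: cvg_id.
have cf : continuous f.
  move=> u; apply: cvgB; first exact: cE.
  by apply: cvgM; [exact: cvg_id|exact: cE].
have f0 : 0 < f 0.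
  by rewrite /f mul0r subr0 /E mulr0 maxxx expint_gt0.
have f1 : f 1 <= 0.
  by rewrite /f /E mul1r mulr1 max_l// subr_le0 expint_le// lerDl.
have [|u] := @IVT R f 0 1 0 ler01 (continuous_subspaceT cf).
  by apply/andP; split; [rewrite ge_min; apply/orP; right|rewrite le_max ltW].
rewrite in_itv/= => /andP[u0 u1] fu.
have {u0} u0 : 0 < u.
  by rewrite lt_neqAle u0 andbT; apply/eqP => u00; move: f0; rewrite {2}u00 fu ltxx.
exists u => //; apply/eqP; rewrite -subr_eq0 -[X in _ == X]fu /f /E max_l//.
by rewrite mulr_ge0// ltW.
Qed.

(** Monotone convergence, which treats bounded and divergent S_i at once. *)
Lemma step_arg_cvg {R : realType} (m : nat -> R) (r alpha pt : R) :
  0 < r -> 0 < alpha -> 0 < pt ->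
  exists2 a : R, 0 <= a & step_arg m r alpha pt i @[i --> \oo] --> a.
Proof.
move=> r0 a0 pt0.
have z0 i : 0 <= step_arg m r alpha pt i.
  by rewrite divr_ge0 ?mulr_ge0 ?ltW// info_sum_gt0.
have cz : cvgn (step_arg m r alpha pt).
  apply: nonincreasing_is_cvgn; last by exists 0 => _ [i _ <-].
  move=> i j ij; rewrite /step_arg ler_pM2l ?mulr_gt0//.
  by rewrite lef_pV2 ?posrE ?mulr_gt0 ?info_sum_gt0// ler_pM2r// info_sum_nondecreasing.
exists (limn (step_arg m r alpha pt)); last exact: cz.
by apply: limr_ge => //; exact: nearW.
Qed.

Theorem mainTheorem4 (R : realType) (m : nat -> R) (r p0 alpha : R)
    (m_neq0 : forall i : nat, m i != 0) (r_gt0 : 0 < r) (p0_gt0 : 0 < p0)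
    (alpha_gt1 : 1 < alpha) :
  (forall pt : R, 0 < pt ->
   forall (d : measure_display) (T : measurableType d) (P : probability T R)
     (X : {RV P >-> R}),
   has_gamma_law alpha (alpha / pt) X ->
   forall i : nat,
   ('E_P[fun w => var_dev m r p0 (X w) i])%E =
   (alpha * model_prod m i ^+ 2 * r ^+ 2 * expR (step_arg m r alpha pt i)
     / (info_sum m i * (info_sum m i * p0 + r))
     * (- (p0 / pt * expint alpha (step_arg m r alpha pt i))
        + expint (alpha + 1) (step_arg m r alpha pt i)))%:E) /\
  exists theta : R,
    0 < theta /\
    mean_dev_vanishes m r p0 alpha (theta * p0) /\
    (mean_dev_vanishes m r p0 alpha (theta * p0) <->
     expR (step_arg m r alpha (theta * p0) i)
       * (expint (alpha + 1) (step_arg m r alpha (theta * p0) i)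
          - p0 / (theta * p0)
            * expint alpha (step_arg m r alpha (theta * p0) i))
     @[i --> \oo] --> (0 : R)).
Proof.
split; first by move=> pt pt0 d T P X lawX i; exact: mean_var_dev.
have alpha0 : 0 < alpha by exact: lt_trans alpha_gt1.
(* The limit a belongs to theta = 1, so u can be chosen from it without circularity; inflating by
   theta = 1 / u then multiplies every argument by u. *)
have [a a0 za] := step_arg_cvg m r alpha p0 r_gt0 alpha0 p0_gt0.
have [u u0 Eu] := expint_balance alpha a alpha_gt1 a0.
exists u^-1; split; first by rewrite invr_gt0.
have pt0 : 0 < u^-1 * p0 by rewrite mulr_gt0 ?invr_gt0.
set z := step_arg m r alpha (u^-1 * p0).
have zu : z i @[i --> \oo] --> a * u.
  rewrite (_ : z = fun i => step_arg m r alpha p0 i * u).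
    exact: cvgMr_tmp.
  apply/funext => i; rewrite /z /step_arg.
  by field; rewrite !gt_eqF// info_sum_gt0.
have z0 i : 0 <= z i.
  by rewrite ltW// divr_gt0 ?mulr_gt0 ?invr_gt0 ?info_sum_gt0.
have au0 : 0 <= a * u by exact: mulr_ge0 (ltW u0).
have Ez n : 1 < n -> expint n (z i) @[i --> \oo] --> expint n (a * u).
  move=> n1; have := continuous_expint n n1 (a * u).
  move=> /(cvg_comp _ _ zu); rewrite (max_l au0).
  apply: cvg_trans; apply: near_eq_cvg; near=> i.
  by rewrite /= max_l.
set lim := (X in mean_dev_vanishes _ _ _ _ _ <-> X).
(* Here p0 / (theta p0) = u, so the limit of the bracket is the balance [Eu]. *)
have bracket : lim.
  rewrite /lim (_ : p0 / (u^-1 * p0) = u); last by field; rewrite !gt_eqF.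
  rewrite -[X in _ --> X](mulr0 (expR (a * u))); apply: cvgM.
    by apply: (cvg_comp _ _ zu); exact: continuous_expR.
  rewrite -(subrr (expint (alpha + 1) (a * u))) {2}Eu; apply: cvgB.
    by apply: Ez; rewrite ltr_wpDr.
  by apply: cvgMl_tmp; exact: Ez.
(* The right side of the equivalence is [bracket], so the vanishing of the mean settles both
   remaining claims. *)
suff vanish : mean_dev_vanishes m r p0 alpha (u^-1 * p0) by [].
move=> d T P X lawX.
pose c i := alpha * model_prod m i ^+ 2 * r ^+ 2 /
  (info_sum m i * (info_sum m i * p0 + r)).
have Sp i : 0 < info_sum m i * (info_sum m i * p0 + r).
  by rewrite mulr_gt0 ?addr_gt0 ?mulr_gt0 ?info_sum_gt0.
have c0 i : 0 <= c i.
  rewrite divr_ge0 ?(ltW (Sp i))//.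
  by rewrite mulr_ge0 ?sqr_ge0// mulr_ge0 ?sqr_ge0// ltW.
(* The bounds M_i^2 <= S_i and r <= S_i p0 + r keep the prefactor, without its exponential, below
   alpha r uniformly in i. *)
have c_le i : c i <= alpha * r.
  have S0 := info_sum_gt0 m i.
  rewrite /c ler_pdivrMr ?Sp//.
  rewrite [leLHS](_ : _ = alpha * r * (model_prod m i ^+ 2 * r)); last by ring.
  rewrite ler_pM2l ?mulr_gt0//.
  rewrite ler_pM ?sqr_ge0 ?(ltW r_gt0) ?model_prod_sqr_le// lerDr.
  by rewrite mulr_ge0 ?ltW.
pose g i := expR (z i) *
  (expint (alpha + 1) (z i) - p0 / (u^-1 * p0) * expint alpha (z i)).
rewrite (_ : (fun i => _) = (fun i => (c i * g i)%:E)); last first.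
  apply/funext => i.
  rewrite (mean_var_dev _ _ _ _ _ _ _ _ _ _ r_gt0 p0_gt0 alpha_gt1 pt0 lawX).
  by rewrite -/z /c /g; congr EFin; ring.
apply: cvg_EFin; first exact: nearW.
apply/norm_cvg0P; apply: (@squeeze_cvgr _ _ _ _ (cst 0) (fun i => alpha * r * `|g i|)).
- apply: nearW => i; rewrite normr_ge0/= normrM (ger0_norm (c0 i)).
  by rewrite ler_wpM2r.
- exact: cvg_cst.
- rewrite -(mulr0 (alpha * r)); apply: cvgMl_tmp; apply/norm_cvg0P; exact: bracket.
Unshelve. all: by end_near. Qed.
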